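(* Let $\varphi:\mathbb{R}^n\to\overline{\mathbb{R}}$ be l.s.c. and prox-bounded with $\bar x\in\operatorname{dom}\varphi$ and $\bar v\in\partial\varphi(\bar x)$, and let $\sigma>0$. Then the following are equivalent: (i) $\varphi$ is variationally strongly convex at $\bar x$ for $\bar v$ with modulus $\sigma$. (ii) $\varphi$ is prox-regular at $\bar x$ for $\bar v$, and the Moreau envelope $e_\lambda\varphi$ is locally strongly convex around $\bar x+\lambda\bar v$ with modulus $\frac{\sigma}{1+\sigma\lambda}$ for all numbers $\lambda>0$ sufficiently small.
   Context: Conventions: $\overline{\mathbb{R}}:=(-\infty,\infty]$; every extended-real-valued function is assumed proper, i.e. $\operatorname{dom}\varphi:=\{x\mid\varphi(x)<\infty\}\neq\emptyset$. $\mathbb{B}_\epsilon(a)$ is the closed ball with center $a$ and radius $\epsilon$; l.s.c. means lower semicontinuous. Subdifferentials: for $\bar x\in\operatorname{dom}\varphi$, the regular subdifferential is $$\widehat\partial\varphi(\bar x)=\Big\{v\in\mathbb{R}^n\;\Big|\;\liminf_{x\to\bar x}\frac{\varphi(x)-\varphi(\bar x)-\langle v,x-\bar x\rangle}{\|x-\bar x\|}\ge 0\Big\},$$ and the limiting subdifferential $\partial\varphi(\bar x)$ is the set of all $v$ for which there are $x_k\to\bar x$ with $\varphi(x_k)\to\varphi(\bar x)$ and $v_k\in\widehat\partial\varphi(x_k)$ with $v_k\to v$. Strong convexity: a function $\psi$ is strongly convex on a convex set $\Omega$ with modulus $\kappa>0$ if $\psi-\frac\kappa2\|\cdot\|^2$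 is convex on $\Omega$. Locally strongly convex around a point with modulus $\kappa$ means strongly convex with modulus $\kappa$ on some convex neighborhood of that point. Variational strong convexity: an l.s.c. function $\varphi$ is variationally strongly convex at $\bar x$ for $\bar v\in\partial\varphi(\bar x)$ with modulus $\sigma>0$ if for some convex neighborhood $U\times V$ of $(\bar x,\bar v)$ there exist an l.s.c. function $\psi\le\varphi$ on $U$, strongly convex on $U$ with modulus $\sigma$, and a number $\epsilon>0$ such that $$(U_\epsilon\times V)\cap\operatorname{gph}\partial\varphi=(U\times V)\cap\operatorname{gph}\partial\psi\quad\text{and}\quad\varphi(x)=\psi(x)\ \text{at the common elements }(x,v),$$ where $U_\epsilon:=\{x\in U\mid\varphi(x)<\varphi(\bar x)+\epsilon\}$. Prox-regularity: an l.s.c. function $\varphi$ is prox-regular at $\bar x\in\operatorname{dom}\varphi$ for $\bar v\in\partial\varphi(\bar x)$ if there exist $\epsilon>0$ and $r\ge0$ such that $\varphi(x)\ge\varphi(u)+\langle v,x-u\rangle-\frac r2\|x-u\|^2$ for all $x\in\mathbb{B}_\epsilon(\bar x)$ and all $(u,v)\in\operatorname{gph}\partial\varphi\cap(\mathbb{B}_\epsilon(\bar x)\times\mathbb{B}_\epsilon(\bar v))$ with $\varphi(u)<\varphi(\bar x)+\epsilon$. Moreau envelope: $e_\lambda\varphi(x):=\inf_{y\in\mathbb{R}^n}\{\varphi(y)+\frac1{2\lambda}\|y-x\|^2\}$ for $\lambda>0$. The function $\varphi$ is prox-bounded if there is $\lambda>0$ with $e_\lambda\varphi(x)>-\infty$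 for some $x\in\mathbb{R}^n$. *)

(* Defs.v *)
From HB Require Import structures.
From mathcomp Require Import all_boot all_order all_algebra.
From mathcomp Require Import all_classical all_reals all_analysis.

Set Implicit Arguments.
Unset Strict Implicit.
Unset Printing Implicit Defensive.

Import Order.TTheory GRing.Theory Num.Theory.
Import numFieldNormedType.Exports.

Local Open Scope classical_set_scope.
Local Open Scope ring_scope.
Local Open Scope ereal_scope.

(* The norm `|x| that the library puts on 'rV[R]_n is the sup norm, so the
   Euclidean structure is defined here. Both norms induce the library's
   topology on 'rV[R]_n, which is the one used for neighborhoods and limits. *)
Definition inner (R : realType) (n : nat) (u v : 'rV[R]_n) : R :=
  (\sum_(i < n) u 0 i * v 0 i)%R.

Definition enorm (R : realType) (n : nat) (u : 'rV[R]_n) : R :=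
  Num.sqrt (inner u u).

Definition eball (R : realType) (n : nat) (a : 'rV[R]_n) (e : R) :
    set 'rV[R]_n :=
  [set x | (enorm (x - a) <= e)%R].

Definition dom (R : realType) (n : nat) (phi : 'rV[R]_n -> \bar R) :
    set 'rV[R]_n :=
  [set x | phi x < +oo].

Definition proper_fun (R : realType) (n : nat) (phi : 'rV[R]_n -> \bar R) :=
  (forall x, -oo < phi x) /\ dom phi !=set0.

(* Both subdifferentials are empty outside dom phi. *)
Definition regular_subdiff (R : realType) (n : nat)
    (phi : 'rV[R]_n -> \bar R) (xbar : 'rV[R]_n) : set 'rV[R]_n :=
  [set v | dom phi xbar /\
    0 <= limf_einf (fun x : 'rV[R]_n =>
           (phi x - phi xbar - (inner v (x - xbar))%:E)
             * ((enorm (x - xbar))^-1)%:E) xbar^'].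

Definition limiting_subdiff (R : realType) (n : nat)
    (phi : 'rV[R]_n -> \bar R) (xbar : 'rV[R]_n) : set 'rV[R]_n :=
  [set v | dom phi xbar /\
    exists x_ v_ : nat -> 'rV[R]_n,
      [/\ x_ k @[k --> \oo] --> xbar,
          phi (x_ k) @[k --> \oo] --> phi xbar,
          forall k, regular_subdiff phi (x_ k) (v_ k) &
          v_ k @[k --> \oo] --> v]].

Definition gph (R : realType) (n : nat)
    (S : 'rV[R]_n -> set 'rV[R]_n) : set ('rV[R]_n * 'rV[R]_n) :=
  [set p | S p.1 p.2].

(* The library's convex_function is for real-valued functions only. *)
Definition econvex_on (R : realType) (n : nat) (A : set 'rV[R]_n)
    (f : 'rV[R]_n -> \bar R) :=
  forall (x y : 'rV[R]_n) (t : R), A x -> A y -> (0 < t < 1)%R ->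
    f (t *: x + (1 - t) *: y)%R <= t%:E * f x + (1 - t)%:E * f y.

Definition strongly_convex_on (R : realType) (n : nat) (kappa : R)
    (A : set 'rV[R]_n) (f : 'rV[R]_n -> \bar R) :=
  econvex_on A (fun x => f x - (kappa / 2 * enorm x ^+ 2)%:E).

Definition locally_strongly_convex (R : realType) (n : nat) (kappa : R)
    (xbar : 'rV[R]_n) (f : 'rV[R]_n -> \bar R) :=
  exists U : set 'rV[R]_n,
    [/\ nbhs xbar U, convex_set U & strongly_convex_on kappa U f].

Definition variationally_strongly_convex (R : realType) (n : nat) (sigma : R)
    (phi : 'rV[R]_n -> \bar R) (xbar vbar : 'rV[R]_n) :=
  exists (U V : set 'rV[R]_n) (psi : 'rV[R]_n -> \bar R) (eps : R),
    let Ueps := [set x | U x /\ phi x < phi xbar + eps%:E] in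
    [/\ [/\ nbhs xbar U, convex_set U, nbhs vbar V & convex_set V],
        [/\ proper_fun psi, lower_semicontinuous psi,
            (forall x, U x -> psi x <= phi x) &
            strongly_convex_on sigma U psi],
        (0 < eps)%R,
        (Ueps `*` V) `&` gph (limiting_subdiff phi) =
          (U `*` V) `&` gph (limiting_subdiff psi) &
        forall x v, ((U `*` V) `&` gph (limiting_subdiff psi)) (x, v) ->
          phi x = psi x].

Definition prox_regular (R : realType) (n : nat)
    (phi : 'rV[R]_n -> \bar R) (xbar vbar : 'rV[R]_n) :=
  exists eps r : R, [/\ (0 < eps)%R, (0 <= r)%R &
    forall x u v : 'rV[R]_n, eball xbar eps x ->
      (gph (limiting_subdiff phi) `&` (eball xbar eps `*` eball vbar eps))
        (u, v) ->
      phi u < phi xbar + eps%:E ->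
      phi u + (inner v (x - u))%:E - (r / 2 * enorm (x - u) ^+ 2)%:E <= phi x].

Definition moreau_envelope (R : realType) (n : nat) (lambda : R)
    (phi : 'rV[R]_n -> \bar R) (x : 'rV[R]_n) : \bar R :=
  ereal_inf (range (fun y : 'rV[R]_n =>
    phi y + ((2 * lambda)^-1 * enorm (y - x) ^+ 2)%:E)).

Definition prox_bounded (R : realType) (n : nat)
    (phi : 'rV[R]_n -> \bar R) :=
  exists2 lambda : R, (0 < lambda)%R &
    exists x : 'rV[R]_n, -oo < moreau_envelope lambda phi x.

(* Main.v *)
(* Write e for the Moreau envelope with parameter lambda, and zbar for
   xbar + lambda vbar. A prox-bounded phi with a quadratic minorant touching it
   at xbar with slope vbar has, for small lambda and z near zbar, a proximal
   point y near xbar, and (z - y) / lambda is then a subgradient of phi at y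
   near vbar.

   (i) => (ii). These pairs lie in the common part of the graphs, so y also
   minimises psi + |. - z|^2 / (2 lambda) over U. Hence e is near zbar the
   envelope of psi, and the infimal convolution of sigma / 2 |.|^2 with
   |.|^2 / (2 lambda) is kappa / 2 |.|^2 with kappa = sigma / (1 + sigma lambda).

   (ii) => (i). Fix one small lambda. By prox-regularity, a subgradient v at u
   near (xbar, vbar) makes u a proximal point of z = u + lambda v, so e has
   at z a quadratic majorant of slope v, and strong convexity yields
   e z' >= e z + <v, z' - z> + kappa / 2 |z' - z|^2. Combined with
   phi x >= e z' - |x - z'|^2 / (2 lambda) at z' = z + (1 + sigma lambda)(x - u)
   this gives phi x >= phi u + <v, x - u> + sigma / 2 |x - u|^2. Let psi be
   the supremum of these minorants. If v is a subgradient of psi at u near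
   (xbar, vbar), then the proximal point y of u + lambda v, with w such that
   u + lambda v = y + lambda w, satisfies (y, w) = (u, v) by the strong
   monotonicity of the subdifferential of psi. *)
Require Import Defs.
From HB Require Import structures.
From mathcomp Require Import all_boot all_order all_algebra.
From mathcomp Require Import all_classical all_reals all_analysis.
From mathcomp Require Import ring lra.

Import Order.TTheory GRing.Theory Num.Theory.
Import numFieldNormedType.Exports.

Local Open Scope classical_set_scope.
Local Open Scope ring_scope.

(** * Euclidean inner product, norm and closed balls *)

Section Euclidean.
Context {R : realType} {n : nat}.
Implicit Types (u v w x y a : 'rV[R]_n) (k e : R).

Lemma innerC u v : inner u v = inner v u.
Proof. by apply: eq_bigr => i _; rewrite mulrC. Qed.

Lemma innerDl u v w : inner (u + v) w = inner u w + inner v w.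
Proof. by rewrite -big_split; apply: eq_bigr => i _; rewrite mxE mulrDl. Qed.

Lemma innerZl k u v : inner (k *: u) v = k * inner u v.
Proof. by rewrite /inner mulr_sumr; apply: eq_bigr => i _; rewrite mxE mulrA. Qed.

Lemma innerNl u v : inner (- u) v = - inner u v.
Proof. by rewrite -scaleN1r innerZl mulN1r. Qed.

Lemma innerDr u v w : inner w (u + v) = inner w u + inner w v.
Proof. by rewrite innerC innerDl !(innerC w). Qed.

Lemma innerZr k u v : inner v (k *: u) = k * inner v u.
Proof. by rewrite innerC innerZl innerC. Qed.

Lemma innerNr u v : inner v (- u) = - inner v u.
Proof. by rewrite innerC innerNl innerC. Qed.

Definition inner_expand :=
  (innerDl, innerDr, innerZl, innerZr, innerNl, innerNr).

Lemma inner_ge0 u : 0 <= inner u u.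
Proof. by apply: sumr_ge0 => i _; rewrite -expr2 sqr_ge0. Qed.

Lemma enorm_ge0 u : 0 <= enorm u.
Proof. exact: sqrtr_ge0. Qed.

Lemma enorm_sqr u : enorm u ^+ 2 = inner u u.
Proof. by rewrite sqr_sqrtr// inner_ge0. Qed.

Lemma enorm_le u k : 0 <= k -> (enorm u <= k) = (inner u u <= k ^+ 2).
Proof. by move=> k0; rewrite -enorm_sqr ler_pXn2r// nnegrE ?enorm_ge0. Qed.

Lemma enorm0 : enorm (0 : 'rV[R]_n) = 0.
Proof. by rewrite /enorm /inner big1 ?sqrtr0// => i _; rewrite mxE mul0r. Qed.

Lemma coord_le_enorm u i : `|u 0 i| <= enorm u.
Proof.
rewrite -sqrtr_sqr ler_sqrt ?inner_ge0// /inner (bigD1 i)//= -expr2 lerDl.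
by apply: sumr_ge0 => j _; rewrite -expr2 sqr_ge0.
Qed.

Lemma norm_le_enorm u : `|u| <= enorm u.
Proof.
rewrite [`|u|]mx_normrE.
apply: bigmax_le => [|[i j] _ /=]; first exact: enorm_ge0.
by rewrite (ord1 i) coord_le_enorm.
Qed.

Lemma enorm_eq0 u : enorm u = 0 -> u = 0.
Proof.
by move=> u0; apply/eqP; rewrite -normr_le0 -u0 norm_le_enorm.
Qed.

(** Cauchy-Schwarz, from expanding the square of [enorm v *: u - enorm u *: v]. *)
Lemma inner_le_enorm u v : inner u v <= enorm u * enorm v.
Proof.
have [/enorm_eq0->|u0] := eqVneq (enorm u) 0.
  by rewrite -(scale0r 0) innerZl scale0r mul0r mulr_ge0 ?enorm_ge0.
have [/enorm_eq0->|v0] := eqVneq (enorm v) 0.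
  by rewrite -(scale0r 0) innerZr scale0r mul0r mulr_ge0 ?enorm_ge0.
have up : 0 < enorm u by rewrite lt_neqAle eq_sym u0 enorm_ge0.
have vp : 0 < enorm v by rewrite lt_neqAle eq_sym v0 enorm_ge0.
have := inner_ge0 (enorm v *: u - enorm u *: v).
rewrite !inner_expand -!enorm_sqr (innerC v u) => h.
have : 0 <= enorm u * enorm v * (enorm u * enorm v - inner u v) by nra.
by rewrite pmulr_rge0 ?mulr_gt0// subr_ge0.
Qed.

Lemma enormD u v : enorm (u + v) <= enorm u + enorm v.
Proof.
rewrite enorm_le ?addr_ge0 ?enorm_ge0// !inner_expand -!enorm_sqr (innerC v u).
have := inner_le_enorm u v; nra.
Qed.

Lemma enormZ k u : enorm (k *: u) = `|k| * enorm u.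
Proof.
by rewrite /enorm innerZl innerZr mulrA -expr2 sqrtrM ?sqr_ge0// sqrtr_sqr.
Qed.

Lemma enormN u : enorm (- u) = enorm u.
Proof. by rewrite -scaleN1r enormZ normrN1 mul1r. Qed.

Lemma enormB u v : enorm (u - v) <= enorm u + enorm v.
Proof. by rewrite -(enormN v) enormD. Qed.

Lemma inner_diag_continuous : continuous (fun x => inner x x).
Proof.
move=> x; apply: (@cvg_big R^o _ _ _ _ (@add_continuous R^o) _ (nbhs x)) => i _.
by apply: cvgM; exact: coord_continuous.
Qed.

Lemma enorm_continuous : continuous (@enorm R n).
Proof.
move=> x; apply: (continuous_comp (inner_diag_continuous x)).
exact: sqrt_continuous.
Qed.

Lemma edist_continuous a : continuous (fun x => enorm (x - a)).
Proof.
move=> x; apply: (@cvg_comp _ _ _ (fun x => x - a) (@enorm R n) (nbhs x)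
  (nbhs (x - a))); last exact: enorm_continuous.
by apply: (@cvgB _ 'rV[R]_n _ (nbhs x)); [exact: cvg_id|exact: cvg_cst].
Qed.

Lemma nbhs_eball a e : 0 < e -> nbhs a (eball a e).
Proof.
move=> e0; have /cvgr_lt := edist_continuous a a.
by move=> /(_ e); rewrite subrr enorm0 => /(_ e0); apply: filterS => x /ltW.
Qed.

Lemma nbhs_eballP a (A : set 'rV[R]_n) :
  nbhs a A <-> exists2 e, 0 < e & eball a e `<=` A.
Proof.
split=> [/nbhs_ballP[e /= e0 eA]|[e e0]]; last first.
  by move/filterS; apply; exact: nbhs_eball.
(* Halving the radius fits the closed Euclidean ball into the open sup-norm ball. *)
exists (e / 2); first by rewrite divr_gt0.
move=> x /= xa; apply: eA; rewrite -ball_normE /= distrC.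
by apply: le_lt_trans (norm_le_enorm _) _; move: xa; rewrite /eball/=; lra.
Qed.

Lemma eball_center a e : 0 <= e -> eball a e a.
Proof. by rewrite /eball/= subrr enorm0. Qed.

Lemma eball_sub a e e' : e <= e' -> eball a e `<=` eball a e'.
Proof. by move=> ee x /=; rewrite /eball/= => /le_trans; apply. Qed.

Lemma compact_eball a e : compact (eball a e).
Proof.
apply: bounded_closed_compact.
  exists (e + enorm a); split; first by rewrite num_real.
  move=> k ek x /= xa; apply: le_trans (norm_le_enorm x) _.
  rewrite -(subrK a x); apply: le_trans (enormD _ _) _.
  by move: xa; rewrite /eball/=; lra.
rewrite (_ : eball a e = (fun x => enorm (x - a)) @^-1` [set y | y <= e])//.
apply: closed_comp; last exact: closed_le.
by move=> x _; exact: edist_continuous.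
Qed.

Lemma eball_convex2 a e x y t : 0 < t < 1 -> eball a e x -> eball a e y ->
  eball a e (t *: x + (1 - t) *: y).
Proof.
move=> /andP[t0 t1]; rewrite /eball/= => xa ya.
have -> : t *: x + (1 - t) *: y - a = t *: (x - a) + (1 - t) *: (y - a).
  by apply/rowP => i; rewrite !mxE; ring.
apply: le_trans (enormD _ _) _; rewrite !enormZ !gtr0_norm//; last by lra.
by nra.
Qed.

Lemma eball_convex a e : convex_set (eball a e : set (convex_lmodType _)).
Proof.
apply/convex_setW => x y /set_mem xa /set_mem ya k k0 k1; apply/mem_set.
by apply: eball_convex2 => //; rewrite k0 k1.
Qed.

End Euclidean.

(** Without a minimiser, the open sets of points [x] with [f t < f x], for [t] in [K], cover [K].
    Among the indices of a finite subcover, one with least value lies in no member of it. *)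
Lemma lsc_compact_min {T : ptopologicalType} {R : realType}
    (f : T -> \bar R) (K : set T) :
  lower_semicontinuous f -> (forall x, -oo < f x)%E -> compact K -> K !=set0 ->
  exists2 c, K c & forall x, K x -> (f c <= f x)%E.
Proof.
move=> /lower_semicontinuousP lscf fN + [x0 Kx0].
rewrite compact_cover => cK.
apply: contrapT => nomin.
have Kno c : K c -> exists2 t, K t & (f t < f c)%E.
  move=> Kc; apply: contrapT => h; apply: nomin; exists c => // x Kx.
  by rewrite leNgt; apply/negP => fx; apply: h; exists x.
have [] := cK T K (fun t => [set x | f t < f x]%E).
- move=> t Kt; move: (fN t); case: (f t) => [r||] // _.
  rewrite (_ : [set _ | _] = set0); first exact: open0.
  by apply/seteqP; split => x //=; rewrite ltNge leey.
- by move=> c /Kno[t Kt ft]; exists t.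
move=> D DK KD.
have minD (s : seq T) : s != [::] ->
    exists2 c, c \in s & forall x, x \in s -> (f c <= f x)%E.
  elim: s => // a [|b s] IH _.
    by exists a; rewrite ?mem_head// => x; rewrite mem_seq1 => /eqP->.
  have [//|c cs cmin] := IH.
  have [ac|ca] := leP (f a) (f c).
    exists a; rewrite ?mem_head// => x; rewrite in_cons => /predU1P[->//|xs].
    exact: le_trans (cmin _ xs).
  exists c; rewrite 1?in_cons ?cs ?orbT// => x; rewrite in_cons => /predU1P[->|].
    exact: ltW.
  exact: cmin.
have [|c cD cmin] := minD (finmap.enum_fset D).
  have [t tD _] := KD _ Kx0; apply/eqP => D0.
  by have : t \in finmap.enum_fset D := tD; rewrite D0.
have [t tD /=] := KD c (set_mem (DK _ cD)).
by rewrite ltNge cmin.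
Qed.

(** * Subgradients and strong convexity as inequalities between reals *)

Section Subdifferentials.
Context {R : realType} {n : nat}.
Implicit Types (u v w x y a : 'rV[R]_n) (phi f : 'rV[R]_n -> \bar R).

Lemma dom_fineK phi x : (-oo < phi x)%E -> dom phi x ->
  phi x = (fine (phi x))%:E.
Proof. by move=> Nx xd; rewrite fineK// fin_real// Nx. Qed.

Lemma slope_ge (p : \bar R) (a b e k : R) : (-oo < p)%E -> 0 < k ->
  ((- e)%:E <= (p - a%:E - b%:E) * (k^-1)%:E)%E = ((a + b - e * k)%:E <= p)%E.
Proof.
move=> + k0; case: p => [p||]// _.
  rewrite -!EFinB -EFinM !lee_fin ler_pdivlMr//.
  by apply/idP/idP; lra.
by rewrite /= gt0_mulye ?lte_fin ?invr_gt0// !leey.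
Qed.

(** The liminf is nonnegative when, for each [e > 0], the quotient is at least [- e] on a punctured
    ball; [slope_ge] clears the denominator, and the center can then be included. *)
Lemma regular_subdiffP phi x v : (forall y, -oo < phi y)%E ->
  regular_subdiff phi x v <->
  dom phi x /\ forall e, 0 < e -> exists2 d, 0 < d & forall y, eball x d y ->
    ((fine (phi x) + inner v (y - x) - e * enorm (y - x))%:E <= phi y)%E.
Proof.
move=> phiN; split=> -[xd]; have xE := dom_fineK phi x (phiN x) xd.
  rewrite limf_einfE => h; split=> // e e0.
  have : ((- e)%:E < ereal_sup [set ereal_inf [set
      ((phi z - phi x - (inner v (z - x))%:E) * ((enorm (z - x))^-1)%:E)%E
        | z in A] | A in x^'])%E.
    by apply: lt_le_trans h; rewrite lte_fin oppr_lt0.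
  move=> /ereal_sup_gt[_ [A xA <-]] eA.
  have /nbhs_eballP[d d0 dA] : nbhs x [set y | y != x -> A y] by exact: xA.
  exists d => // y /dA /= yA.
  have [->|yx] := eqVneq y x.
    rewrite subrr enorm0 mulr0 subr0 /inner big1 ?addr0 -?xE// => i _.
    by rewrite mxE mulr0.
  have yx0 : 0 < enorm (y - x).
    rewrite lt_neqAle enorm_ge0 andbT eq_sym; apply: contra_neq yx.
    by move=> /enorm_eq0/eqP; rewrite subr_eq0 => /eqP.
  rewrite -slope_ge// -xE; apply: (le_trans (ltW eA)).
  by apply: ereal_inf_lbound; exists y => //; exact: yA.
move=> h; split=> //; rewrite limf_einfE.
apply/lee_addgt0Pr => e e0; have [d d0 dphi] := h e e0.
rewrite -leeBlDr// sub0e -EFinN.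
apply: le_ereal_sup_tmp; eexists.
  exists [set y | y != x /\ eball x d y]; last reflexivity.
  by apply: filterS (nbhs_eball x d d0) => y yd yx; split.
apply: le_ereal_inf_tmp => _ [y [yx yd] <-].
have yx0 : 0 < enorm (y - x).
  rewrite lt_neqAle enorm_ge0 andbT eq_sym; apply: contra_neq yx.
  by move=> /enorm_eq0/eqP; rewrite subr_eq0 => /eqP.
by rewrite xE slope_ge//; exact: dphi.
Qed.

Lemma regular_sub_limiting phi x :
  regular_subdiff phi x `<=` limiting_subdiff phi x.
Proof.
move=> v xv; split; first by case: xv.
by exists (fun=> x), (fun=> v); split => //; exact: cvg_cst.
Qed.

(** Within distance [e / (c + 1)] of [x] the quadratic term is at most [e * enorm (y - x)]. *)
Lemma quadratic_minorant_subdiff phi x v (c : R) : (forall y, -oo < phi y)%E ->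
  0 <= c -> dom phi x ->
  (forall y, (fine (phi x) + inner v (y - x) - c * enorm (y - x) ^+ 2)%:E
     <= phi y)%E ->
  regular_subdiff phi x v.
Proof.
move=> phiN c0 xd h; apply/regular_subdiffP => //; split => // e e0.
exists (e / (c + 1)) => [|y]; first by rewrite divr_gt0//; lra.
rewrite /eball/= ler_pdivlMr; last by lra.
move=> yx; apply: le_trans (h y); rewrite lee_fin.
by have := enorm_ge0 (y - x); nra.
Qed.

Lemma strongly_convex_le phi (A : set 'rV[R]_n) (kappa : R) x y (t a b : R) :
  strongly_convex_on kappa A phi -> A x -> A y -> 0 < t < 1 ->
  phi x = a%:E -> phi y = b%:E ->
  (phi (t *: x + (1 - t) *: y)%R <=
   (t * a + (1 - t) * b - kappa / 2 * (t * (1 - t)) * enorm (x - y) ^+ 2)%:E)%E.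
Proof.
move=> h Ax Ay t01 xE yE; have := h x y t Ax Ay t01.
rewrite xE yE -!EFinB -!EFinM -EFinD leeBlDr// -EFinD.
move/le_trans; apply; rewrite lee_fin !enorm_sqr !inner_expand (innerC y x).
by rewrite le_eqVlt; apply/orP; left; apply/eqP; ring.
Qed.

(** Infinite values make the right-hand side [+oo], so only finite ones have to be checked. *)
Lemma strongly_convex_intro phi (A : set 'rV[R]_n) (kappa : R) :
  (forall x, A x -> -oo < phi x)%E ->
  (forall x y (t a b : R), A x -> A y -> 0 < t < 1 ->
    phi x = a%:E -> phi y = b%:E ->
    (phi (t *: x + (1 - t) *: y)%R <= (t * a + (1 - t) * b
      - kappa / 2 * (t * (1 - t)) * enorm (x - y) ^+ 2)%:E)%E) ->
  strongly_convex_on kappa A phi.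
Proof.
move=> phiN h x y t Ax Ay t01; have /andP[t0 t1] := t01.
have t1' : 0 < 1 - t by lra.
case xE : (phi x) (phiN x Ax) => [a||]//= _; last first.
  rewrite gt0_muley ?lte_fin// addye ?leey//.
  by case: (phi y) (phiN y Ay) => //= _; rewrite gt0_muley ?lte_fin.
case yE : (phi y) (phiN y Ay) => [b||]//= _; last first.
  by rewrite gt0_muley ?lte_fin// addey ?leey.
rewrite EFinN leeBlDr//; apply: le_trans (h x y t a b Ax Ay t01 xE yE) _.
rewrite -?EFinN -?EFinD -?EFinM -?EFinD.
rewrite lee_fin !enorm_sqr !inner_expand (innerC y x).
by rewrite le_eqVlt; apply/orP; left; apply/eqP; ring.
Qed.

End Subdifferentials.

(** * Quadratic growth of strongly convex functions above their subgradients *)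

Section StronglyConvex.
Context {R : realType} {n : nat}.
Implicit Types (u v w x y a : 'rV[R]_n) (phi psi : 'rV[R]_n -> \bar R).

Lemma exists_small_multiple (A B d e : R) : 0 <= A -> 0 <= B -> 0 < d -> 0 < e ->
  exists t : R, [/\ 0 < t < 1, t * A <= d & t * B <= e].
Proof.
move=> A0 B0 d0 e0.
(* The added 1 keeps the denominators positive when [A] or [B] is 0. *)
exists (Num.min (1 / 2) (Num.min (d / (A + 1)) (e / (B + 1)))).
have A1 : 0 < A + 1 by lra.
have B1 : 0 < B + 1 by lra.
set t := Num.min _ _.
have t0 : 0 < t by rewrite !lt_min !divr_gt0//; lra.
have th : t <= 1 / 2 by rewrite ge_min lexx.
have td : t * (A + 1) <= d by rewrite -ler_pdivlMr// !ge_min lexx !orbT.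
have te : t * (B + 1) <= e by rewrite -ler_pdivlMr// !ge_min lexx !orbT.
by split; nra.
Qed.

Lemma cvg_inner (T : Type) (F : set_system T) (FF : Filter F)
    (f g : T -> 'rV[R]_n) u v :
  f x @[x --> F] --> u -> g x @[x --> F] --> v ->
  inner (f x) (g x) @[x --> F] --> inner u v.
Proof.
move=> fu gv; apply: (@cvg_big R^o _ _ _ _ (@add_continuous R^o) _ F) => i _.
apply: cvgM.
  exact: (cvg_comp _ _ fu (@coord_continuous R 1 n 0 i u)).
exact: (cvg_comp _ _ gv (@coord_continuous R 1 n 0 i v)).
Qed.

(** At [u + t (x - u)] the subgradient bounds [psi] from below and strong convexity bounds it from
    above. Dividing by a small [t] leaves the claim up to [e]. *)
Lemma strongly_convex_regular psi (U : set 'rV[R]_n) (sigma : R) u v x :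
  (forall y, -oo < psi y)%E -> 0 <= sigma -> strongly_convex_on sigma U psi ->
  U u -> U x -> regular_subdiff psi u v ->
  ((fine (psi u) + inner v (x - u) + sigma / 2 * enorm (x - u) ^+ 2)%:E
    <= psi x)%E.
Proof.
move=> psiN s0 sc Uu Ux.
move=> /(regular_subdiffP _ _ _ psiN)[ud vu].
have uE := dom_fineK _ _ (psiN u) ud.
case xE : (psi x) (psiN x) => [b||] // _; last by rewrite leey.
rewrite lee_fin; set a := fine (psi u) in uE vu *.
set h := enorm (x - u); have h0 : 0 <= h by exact: enorm_ge0.
apply/ler_addgt0Pr => e e0.
(* After division by [t], one half of [e] pays for the first-order error, the other for the term
   [t * (sigma / 2 * h ^+ 2)] that comes from the factor [1 - t]. *)
have [d d0 vd] := vu (e / 2 / (h + 1)) ltac:(by rewrite !divr_gt0//; lra).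
have [t [t01 td te]] : exists t, [/\ 0 < t < 1, t * h <= d &
    t * (sigma / 2 * h ^+ 2) <= e / 2].
  by apply: exists_small_multiple => //; [nra|lra].
have [t0 t1] := andP t01.
have hu : (t *: x + (1 - t) *: u) - u = t *: (x - u).
  by apply/rowP => i; rewrite !mxE; ring.
have := strongly_convex_le _ _ _ _ _ _ _ _ sc Ux Uu t01 xE uE.
have := vd (t *: x + (1 - t) *: u).
rewrite /eball/= hu enormZ innerZr gtr0_norm// => /(_ td) h1 h2.
have := le_trans h1 h2; rewrite lee_fin -/h.
set c := inner v _.
have -> : e / 2 / (h + 1) * (t * h) = t * (e / 2 * (h / (h + 1))).
  by field; lra.
have : e / 2 * (h / (h + 1)) <= e / 2.
  by rewrite ler_piMr ?ler_pdivrMr; lra.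
by move: (_ * (h / _)) => k; nra.
Qed.

(** The regular inequality holds at [x_ k] once [x_ k] enters [U], and it passes to the limit
    because [psi (x_ k)] converges to [psi u]. *)
Lemma strongly_convex_limiting psi (U : set 'rV[R]_n) (sigma : R) u v x :
  (forall y, -oo < psi y)%E -> 0 <= sigma -> strongly_convex_on sigma U psi ->
  nbhs u U -> U x -> limiting_subdiff psi u v ->
  ((fine (psi u) + inner v (x - u) + sigma / 2 * enorm (x - u) ^+ 2)%:E
    <= psi x)%E.
Proof.
move=> psiN s0 sc uU Ux [ud [x_ [v_ [xu pxu xv vv]]]].
have uE := dom_fineK _ _ (psiN u) ud.
case xE : (psi x) (psiN x) => [b||] // _; last by rewrite leey.
rewrite lee_fin.
have near_le : \forall k \near \oo, fine (psi (x_ k)) + inner (v_ k) (x - x_ k) +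
    sigma / 2 * inner (x - x_ k) (x - x_ k) <= b.
  have : \forall k \near \oo, U (x_ k) := xu _ uU.
  apply: filterS => k Uk.
  rewrite -lee_fin -xE -enorm_sqr.
  exact: (strongly_convex_regular _ _ _ _ _ _ psiN s0 sc).
have dx : x - x_ k @[k --> \oo] --> x - u by apply: cvgB => //; exact: cvg_cst.
have fc : fine (psi (x_ k)) @[k --> \oo] --> fine (psi u).
  by rewrite uE in pxu; have := fine_cvg pxu; exact.
have lim : fine (psi (x_ k)) + inner (v_ k) (x - x_ k) +
    sigma / 2 * inner (x - x_ k) (x - x_ k) @[k --> \oo] -->
    fine (psi u) + inner v (x - u) + sigma / 2 * inner (x - u) (x - u).
  apply: (@cvgD _ R^o); first by apply: (@cvgD _ R^o) => //; exact: cvg_inner.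
  by apply: cvgM; [exact: cvg_cst|exact: cvg_inner].
by rewrite enorm_sqr; apply: (cvgr_to_le lim).
Qed.

End StronglyConvex.

(** * Proximal points, Moreau envelopes and quadratic minorants *)

Section ProximalPoints.
Context {R : realType} {n : nat}.
Implicit Types (u v w x y z : 'rV[R]_n) (phi : 'rV[R]_n -> \bar R) (lambda : R).

Lemma lscD_continuous phi (h : 'rV[R]_n -> R) :
  lower_semicontinuous phi -> continuous h ->
  lower_semicontinuous (fun x => phi x + (h x)%:E)%E.
Proof.
move=> lsc ch x a ax.
(* The level [a] is split as [b + (a - b)], each part strictly below its summand at [x]. *)
have [b ab bx] : exists2 b : R, a - h x < b & (b%:E < phi x)%E.
  move: ax; case: (phi x) => [p||] //.
    rewrite -EFinD lte_fin => ap; exists ((a - h x + p) / 2); first by lra.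
    by rewrite lte_fin; lra.
  by exists (a - h x + 1); rewrite ?ltry//; lra.
have [V xV Vb] := lsc x b bx.
have hx : \forall y \near x, a - b < h y.
  by have /cvgr_gt := ch x; apply; lra.
exists (V `&` [set y | a - b < h y]); first exact: filterI.
move=> y [/Vb by_ /= hy].
have -> : a%:E = (b%:E + (a - b)%:E)%E by rewrite -EFinD; congr EFin; ring.
by rewrite lteD// lte_fin.
Qed.

(* [y] minimises [phi + |. - z|^2 / (2 lambda)], stated as a lower bound on
   [phi] so that no extended-real subtraction occurs. *)
Definition is_prox phi lambda z y := dom phi y /\ forall x,
  ((fine (phi y) + (2 * lambda)^-1 * (enorm (y - z) ^+ 2 - enorm (x - z) ^+ 2))%:E
    <= phi x)%E.

Lemma moreau_envelope_le phi lambda z y (a : R) : (phi y <= a%:E)%E ->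
  (moreau_envelope lambda phi z <=
    (a + (2 * lambda)^-1 * enorm (y - z) ^+ 2)%:E)%E.
Proof.
move=> ya; apply: ge_ereal_inf; eexists; first by exists y.
by rewrite EFinD leeD2r.
Qed.

Lemma is_prox_envelope phi lambda z y : (forall x, -oo < phi x)%E ->
  is_prox phi lambda z y -> moreau_envelope lambda phi z =
    (fine (phi y) + (2 * lambda)^-1 * enorm (y - z) ^+ 2)%:E.
Proof.
move=> phiN [yd ymin]; apply/eqP; rewrite eq_le; apply/andP; split.
  by apply: moreau_envelope_le; rewrite -dom_fineK.
apply: le_ereal_inf_tmp => _ [x _ <-].
rewrite -leeBlDr// -EFinB; apply: le_trans (ymin x).
by rewrite lee_fin; lra.
Qed.

Lemma is_prox_subdiff phi lambda z y : (forall x, -oo < phi x)%E ->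
  0 < lambda -> is_prox phi lambda z y ->
  regular_subdiff phi y (lambda^-1 *: (z - y)).
Proof.
move=> phiN l0 [yd ymin].
apply: (quadratic_minorant_subdiff _ _ _ (2 * lambda)^-1) => // [|x].
  by rewrite invr_ge0; lra.
apply: le_trans (ymin x); rewrite lee_fin !enorm_sqr !inner_expand.
rewrite (innerC z x) (innerC y x) (innerC z y) le_eqVlt.
apply/orP; left; apply/eqP.
by field; lra.
Qed.

(** As [K] is below [k = 1 / (2 lambda)], the objective grows around [xbar] at least like
    [c |x - xbar|^2] with [c = k - K], up to a linear term controlled by the shift [q] of [z]. A
    minimiser over a small ball is therefore global. *)
Lemma is_prox_localized phi xbar vbar (K lambda eta : R) :
  (forall x, -oo < phi x)%E -> lower_semicontinuous phi -> dom phi xbar ->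
  (forall x, (fine (phi xbar) + inner vbar (x - xbar)
     - K * enorm (x - xbar) ^+ 2)%:E <= phi x)%E ->
  0 < lambda -> 2 * K * lambda < 1 -> 0 < eta ->
  exists2 delta, 0 < delta &
    forall z, eball (xbar + lambda *: vbar) delta z -> exists y,
      [/\ is_prox phi lambda z y, eball xbar eta y,
          eball vbar eta (lambda^-1 *: (z - y)) &
          (phi y < phi xbar + eta%:E)%E].
Proof.
move=> phiN lsc xd minor l0 Kl eta0.
have xE := dom_fineK _ _ (phiN xbar) xd; set a := fine (phi xbar) in xE minor.
set k := (2 * lambda)^-1; have [c cE] : exists c, c = k - K by eexists.
have k0 : 0 < k by rewrite invr_gt0; lra.
have lk : lambda^-1 = 2 * k by rewrite /k; field; lra.
have c0 : 0 < c.
  have : k * (1 - 2 * K * lambda) = c by rewrite cE /k; field; lra.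
  by move<-; rewrite mulr_gt0//; lra.
(* The first bound on [rho] localises [y] and its subgradient, the second the value [phi y]. *)
have [rho [/andP[rho0 rho1] rho2 rho3]] : exists t : R, [/\ 0 < t < 1,
    t * (1 + c + 2 * k) <= eta & t * (enorm vbar + c) <= eta / 2].
  by have v0 := enorm_ge0 vbar; apply: exists_small_multiple; lra.
(* With this radius the linear term is at most [c * rho * enorm (x - xbar)], which quadratic growth
   dominates outside the ball of radius [rho]. *)
exists (lambda * c * rho) => [|z]; first by rewrite !mulr_gt0.
rewrite /eball/=; set q := z - (xbar + lambda *: vbar) => qd.
have qd2 : 2 * k * enorm q <= c * rho.
  by rewrite -lk mulrC ler_pdivrMr// mulrC mulrA.
have zE : z = xbar + lambda *: vbar + q by rewrite /q addrC subrK.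
clearbody q.
(* The term [- inner vbar (x - xbar)] cancels the slope of the minorant. *)
have diff x : k * (enorm (x - z) ^+ 2 - enorm (xbar - z) ^+ 2) =
    k * enorm (x - xbar) ^+ 2 - inner vbar (x - xbar)
      - 2 * k * inner (x - xbar) q.
  have -> : x - z = (x - xbar) - (lambda *: vbar + q).
    by rewrite zE; apply/rowP => i; rewrite !mxE; ring.
  have -> : xbar - z = - (lambda *: vbar + q).
    by rewrite zE; apply/rowP => i; rewrite !mxE; ring.
  move: (x - xbar) => d; rewrite !enorm_sqr !inner_expand.
  rewrite (innerC vbar d) (innerC q d) (innerC vbar q).
  by rewrite /k; field; lra.
have diff_ge x : 0 <= enorm (x - xbar) ->
  2 * k * inner (x - xbar) q <= c * rho * enorm (x - xbar).
  move=> d0; have := inner_le_enorm (x - xbar) q.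
  move=> /(ler_wpM2l (ltW k0)).
  by have := ler_wpM2r d0 qd2; lra.
have [y ybar ymin] : exists2 y, eball xbar rho y & forall x, eball xbar rho x ->
    (phi y + (k * inner (y - z) (y - z))%:E <=
     phi x + (k * inner (x - z) (x - z))%:E)%E.
  apply: (lsc_compact_min (fun x => phi x + (k * inner (x - z) (x - z))%:E)%E).
  - apply: lscD_continuous => // x.
    have cB : y - z @[y --> x] --> x - z.
      by apply: (@cvgB _ 'rV[R]_n _ (nbhs x)); [exact: cvg_id|exact: cvg_cst].
    apply: (@cvgM _ _ (nbhs x)); first exact: cvg_cst.
    exact: (cvg_inner _ _ _ _ _ _ _ cB cB).
  - by move=> x; case: (phi x) (phiN x) => //= r _; rewrite ltNyr.
  - exact: compact_eball.
  - by exists xbar; apply: eball_center; lra.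
have := ymin xbar (eball_center _ _ (ltW rho0)); rewrite xE -EFinD.
rewrite -!enorm_sqr => yx.
have yd : dom phi y.
  by move: yx; rewrite /dom/=; case: (phi y) => //= r; rewrite ltry.
have yE := dom_fineK _ _ (phiN y) yd; set b := fine (phi y) in yE.
have {}yx : b + k * (enorm (y - z) ^+ 2 - enorm (xbar - z) ^+ 2) <= a.
  by move: yx; rewrite yE -EFinD lee_fin; lra.
have d0 := enorm_ge0 (y - xbar).
have ydiff := diff_ge _ d0.
have yr : enorm (y - xbar) <= rho by exact: ybar.
exists y; split.
- split=> // x; rewrite -/b -/k.
  have [xr|xr] := leP (enorm (x - xbar)) rho.
    have := ymin x xr; rewrite yE -!enorm_sqr -EFinD.
    case: (phi x) (phiN x) => [p||]//=; rewrite ?leey// -?EFinD ?lee_fin; lra.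
  (* Outside the ball the objective is at least its value at [xbar], hence at least that at [y]. *)
  apply: le_trans (minor x); rewrite lee_fin.
  have x0 : 0 <= enorm (x - xbar) by exact: enorm_ge0.
  have := diff x; have := diff_ge x x0.
  have : c * rho * enorm (x - xbar) <= c * enorm (x - xbar) ^+ 2.
    by rewrite -mulrA ler_pM2l// expr2 ler_wpM2r// ltW.
  by rewrite cE; lra.
- rewrite /eball/=; nra.
- rewrite /eball/=.
  have -> : lambda^-1 *: (z - y) - vbar = lambda^-1 *: (q - (y - xbar)).
    by rewrite zE; apply/rowP => i; rewrite !mxE; field; lra.
  rewrite enormZ gtr0_norm ?invr_gt0// lk.
  have := enormB q (y - xbar); nra.
- rewrite yE -EFinD lte_fin.
  have := diff y; have := inner_le_enorm vbar (y - xbar).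
  have := enorm_ge0 vbar; move: (enorm vbar) rho3 => nv rho3 nv0 cs dy.
  have : nv * enorm (y - xbar) <= rho * nv by rewrite mulrC ler_wpM2r.
  have : c * rho * enorm (y - xbar) <= rho * c.
    by rewrite (mulrC rho) ler_piMr ?mulr_ge0 ?ltW//; lra.
  have := mulr_ge0 (ltW k0) (sqr_ge0 (enorm (y - xbar))); lra.
Qed.

(** A finite lower bound on one envelope value gives a quadratic minorant of [phi] with another
    center. Farther than [eps] from [xbar], its constant and linear discrepancies are absorbed by a
    multiple of [|x - xbar|^2]. *)
Lemma prox_bounded_minorant phi xbar vbar (eps r : R) :
  (forall x, -oo < phi x)%E -> prox_bounded phi -> dom phi xbar ->
  0 < eps -> 0 <= r ->
  (forall x, eball xbar eps x -> (fine (phi xbar) + inner vbar (x - xbar)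
     - r / 2 * enorm (x - xbar) ^+ 2)%:E <= phi x)%E ->
  exists2 K, 0 <= K & forall x, ((fine (phi xbar) + inner vbar (x - xbar)
     - K * enorm (x - xbar) ^+ 2)%:E <= phi x)%E.
Proof.
move=> phiN [l0 l0p [x0 ex0]] xd eps0 r0 loc; set a := fine (phi xbar) in loc *.
pose k := (2 * l0)^-1.
have k0 : 0 < k by rewrite invr_gt0; lra.
have [m mle] : exists m : R, (m%:E <= moreau_envelope l0 phi x0)%E.
  move: ex0; case: (moreau_envelope l0 phi x0) => [p||]// _; first by exists p.
  by exists 0; rewrite leey.
pose s : R := enorm (xbar - x0).
have s0 : 0 <= s by exact: enorm_ge0.
pose M : R := `|m - a| + 2 * k * s ^+ 2.
have M0 : 0 <= M by rewrite /M addr_ge0// mulr_ge0 ?sqr_ge0//; lra.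
have v0 := enorm_ge0 vbar.
have Me : 0 <= M / eps ^+ 2 by rewrite divr_ge0 ?sqr_ge0.
have ve : 0 <= enorm vbar / eps by apply: divr_ge0; lra.
(* The summands serve, in order, the local minorant, the change of center from [x0] to [xbar], the
   constants collected in [M], and the linear term. *)
exists (r / 2 + 2 * k + M / eps ^+ 2 + enorm vbar / eps) => [|x].
  by move: Me ve; move: (M / _) (_ / eps) => A B; lra.
set D := enorm (x - xbar); have D0 : 0 <= D by exact: enorm_ge0.
have [xe|xe] := leP D eps.
  apply: le_trans (loc x xe); rewrite lee_fin -/D.
  have : 0 <= (2 * k + M / eps ^+ 2 + enorm vbar / eps) * D ^+ 2.
    by rewrite mulr_ge0 ?sqr_ge0// !addr_ge0// mulr_ge0// ltW.
  by move: (M / _) (_ / eps) => A B; lra.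
have phix : ((m - k * enorm (x - x0) ^+ 2)%:E <= phi x)%E.
  rewrite EFinB leeBlDr//; apply: le_trans mle _.
  by apply: ereal_inf_lbound; exists x.
apply: le_trans phix; rewrite lee_fin.
have xx0 : enorm (x - x0) ^+ 2 <= 2 * D ^+ 2 + 2 * s ^+ 2.
  have := enormD (x - xbar) (xbar - x0); rewrite addrA subrK -/D -/s.
  by have := enorm_ge0 (x - x0); have := sqr_ge0 (D - s); nra.
have kxx0 := ler_wpM2l (ltW k0) xx0.
have vD : inner vbar (x - xbar) <= enorm vbar / eps * D ^+ 2.
  apply: le_trans (inner_le_enorm _ _) _; rewrite -/D expr2 mulrA ler_wpM2r//.
  by rewrite -mulrA ler_peMr// mulrC ler_pdivlMr// mul1r ltW.
have MD : M <= M / eps ^+ 2 * D ^+ 2.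
  rewrite -mulrA ler_peMr// mulrC ler_pdivlMr ?exprn_gt0// mul1r.
  by apply: lerXn2r; rewrite ?nnegrE; lra.
have ma : a - m <= `|m - a| by rewrite distrC ler_norm.
have rD : 0 <= r / 2 * D ^+ 2 by rewrite mulr_ge0 ?sqr_ge0//; lra.
move: vD MD; rewrite {1}/M; move: (M / _) (enorm vbar / _) => A B; lra.
Qed.

End ProximalPoints.

(** * From variational strong convexity to the envelope *)

Section VariationalToEnvelope.
Context {R : realType} {n : nat}.
Implicit Types (u v w x y z : 'rV[R]_n) (phi psi : 'rV[R]_n -> \bar R).

Lemma nbhs_eball_lt (a x : 'rV[R]_n) (e e' : R) :
  e < e' -> eball a e x -> nbhs x (eball a e').
Proof.
move=> ee xa; apply/nbhs_eballP; exists (e' - e); first by rewrite subr_gt0.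
move=> y; move: xa; rewrite /eball/= => xa yx.
have -> : y - a = (y - x) + (x - a) by rewrite addrA subrK.
by have := enormD (y - x) (x - a); lra.
Qed.

Lemma near_0_right_lt (c : R) : 0 < c -> \forall l \near 0^'+, 0 < l < c.
Proof.
move=> c0; near=> l; apply/andP; split.
  by near: l; exact: nbhs_right_gt.
by near: l; exact: nbhs_right_lt.
Unshelve. all: by end_near. Qed.

(** The difference of the two sides is a nonnegative multiple of the square of
    [a - (1 + sigma * lambda)^-1 *: b]. *)
Lemma inf_convolution_sqr (sigma lambda : R) (a b : 'rV[R]_n) :
  0 < sigma -> 0 < lambda ->
  sigma / (1 + sigma * lambda) / 2 * inner b b <=
  sigma / 2 * inner a a + (2 * lambda)^-1 * inner (a - b) (a - b).
Proof.
move=> s0 l0; have sl : 0 < sigma * lambda by rewrite mulr_gt0.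
rewrite -subr_ge0 [leRHS](_ : _ = (1 + sigma * lambda) / (2 * lambda) *
    inner (a - (1 + sigma * lambda)^-1 *: b) (a - (1 + sigma * lambda)^-1 *: b)).
  by rewrite mulr_ge0 ?inner_ge0// divr_ge0; lra.
by rewrite !inner_expand (innerC b a); field; apply/andP; split; lra.
Qed.

(** The gap is [|x - y|^2 / (2 lambda)]. Thus an affine minorant of slope [(z - y) / lambda]
    touching a function at [y] makes [y] a proximal point of [z] for it. *)
Lemma prox_step (lambda : R) (y z x : 'rV[R]_n) : 0 < lambda ->
  (2 * lambda)^-1 * inner (y - z) (y - z) <=
  inner (lambda^-1 *: (z - y)) (x - y) + (2 * lambda)^-1 * inner (x - z) (x - z).
Proof.
move=> l0; rewrite -subr_ge0.
rewrite [leRHS](_ : _ = (2 * lambda)^-1 * inner (x - y) (x - y)).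
  by rewrite mulr_ge0 ?inner_ge0// invr_ge0; lra.
rewrite !inner_expand (innerC z x) (innerC y x) (innerC z y).
by field; lra.
Qed.

Lemma inner_convex_comb (t : R) (a b : 'rV[R]_n) :
  inner (t *: a + (1 - t) *: b) (t *: a + (1 - t) *: b) =
  t * inner a a + (1 - t) * inner b b - t * (1 - t) * inner (a - b) (a - b).
Proof. by rewrite !inner_expand (innerC b a); ring. Qed.

Lemma variational_convexity_envelope phi xbar vbar (sigma : R) :
  proper_fun phi -> lower_semicontinuous phi -> prox_bounded phi ->
  dom phi xbar -> limiting_subdiff phi xbar vbar -> 0 < sigma ->
  variationally_strongly_convex sigma phi xbar vbar ->
  prox_regular phi xbar vbar /\
  \forall lambda \near 0^'+,
    locally_strongly_convex (sigma / (1 + sigma * lambda))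
      (xbar + lambda *: vbar) (moreau_envelope lambda phi).
Proof.
move=> [phiN _] lsc pb xd xv s0 [U [V [psi [eps [[nU cU nV cV]
  [[psiN _] _ psiphi sc] eps0 gphE valE]]]]].
have xE := dom_fineK _ _ (phiN xbar) xd.
have /nbhs_eballP[d1 d10 dU] := nU.
have /nbhs_eballP[d2 d20 dV] := nV.
(* Halving [d1] makes [U] a neighborhood of every point of the closed [d]-ball, as limiting
   subgradients require. *)
pose d := Num.min (d1 / 2) (Num.min d2 eps).
have d0 : 0 < d by rewrite !lt_min d20 eps0 divr_gt0.
have dd1 : d < d1.
  have : d <= d1 / 2 by rewrite ge_min lexx.
  lra.
have dd2 : d <= d2 by rewrite !ge_min lexx !orbT.
have deps : d <= eps by rewrite !ge_min lexx !orbT.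
have BU : eball xbar d `<=` U.
  by move=> x xb; apply: dU; exact: eball_sub _ _ _ (ltW dd1) _ xb.
(* Such a pair belongs to the common part of the graphs, so the growth inequality for [psi] starts
   from the value [phi u]. *)
have key u v : eball xbar d u -> eball vbar d v ->
    (phi u < phi xbar + d%:E)%E -> limiting_subdiff phi u v ->
    psi u = phi u /\ forall x, U x ->
    ((fine (phi u) + inner v (x - u) + sigma / 2 * enorm (x - u) ^+ 2)%:E
      <= psi x)%E.
  move=> ub vb pu uv.
  have Uu := BU _ ub.
  have Vv : V v by apply: dV; exact: eball_sub _ _ _ dd2 _ vb.
  have : ((U `*` V) `&` gph (limiting_subdiff psi)) (u, v).
    rewrite -gphE; split=> //; split=> //; split=> //=.
    by apply: lt_le_trans pu _; rewrite leeD2l// lee_fin.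
  move=> psiuv; have uE := valE _ _ psiuv.
  case: psiuv => _ /= psiuv; split => // x Ux.
  rewrite uE; apply: (strongly_convex_limiting _ U _ _ _ _ psiN) => //.
    exact: ltW.
  by apply: filterS dU _; exact: nbhs_eball_lt dd1 ub.
have xbarlt (e : R) : 0 < e -> (phi xbar < phi xbar + e%:E)%E.
  by move=> e0; rewrite xE -EFinD lte_fin; lra.
have [_ keybar] : psi xbar = phi xbar /\ forall x, U x ->
    ((fine (phi xbar) + inner vbar (x - xbar) +
      sigma / 2 * enorm (x - xbar) ^+ 2)%:E <= psi x)%E.
  apply: key => //; [exact/eball_center/ltW|exact/eball_center/ltW|].
  exact: xbarlt.
split.
  exists d, 0; split => // x u v xb [/= uv [ub vb]] pu.
  have [psiu keyu] := key u v ub vb pu uv.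
  have uE := dom_fineK _ _ (phiN u) uv.1.
  apply: le_trans (psiphi x (BU _ xb)); apply: le_trans (keyu x (BU _ xb)).
  rewrite [X in (X + _ + _)%E]uE -!EFinD lee_fin !mul0r subr0 lerDl.
  by rewrite mulr_ge0 ?sqr_ge0//; lra.
have [K K0 minor] : exists2 K, 0 <= K &
    forall x, ((fine (phi xbar) + inner vbar (x - xbar)
     - K * enorm (x - xbar) ^+ 2)%:E <= phi x)%E.
  apply: (prox_bounded_minorant _ _ _ d 0) => // x xb.
  apply: le_trans (psiphi x (BU _ xb)); apply: le_trans (keybar x (BU _ xb)).
  rewrite lee_fin mul0r mul0r subr0 lerDl.
  by rewrite mulr_ge0 ?sqr_ge0//; lra.
(* Every [l] below this threshold satisfies [2 * K * l < 1]. *)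
have K1 : 0 < (2 * K + 1)^-1 by rewrite invr_gt0; lra.
apply: filterS (near_0_right_lt _ K1) => l /andP[l0 lK].
have Kl : 2 * K * l < 1.
  have : l * (2 * K + 1) < 1 by rewrite -ltr_pdivlMr ?div1r//; lra.
  lra.
have [delta delta0 loc] :=
  is_prox_localized _ _ _ _ _ _ phiN lsc xd minor l0 Kl d0.
have sub z y : is_prox phi l z y -> limiting_subdiff phi y (l^-1 *: (z - y)).
  by move=> h; apply: regular_sub_limiting; exact: is_prox_subdiff.
exists (eball (xbar + l *: vbar) delta); split.
- exact: nbhs_eball.
- exact: eball_convex.
apply: strongly_convex_intro.
  by move=> z /loc[y [/(is_prox_envelope _ _ _ _ phiN)-> _ _ _]]; rewrite ltNyr.
move=> z1 z2 t a1 a2 z1b z2b t01.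
have [y1 [p1 yb1 w1 lt1]] := loc _ z1b.
have [y2 [p2 yb2 w2 lt2]] := loc _ z2b.
have [y [p yb w ylt]] := loc _ (eball_convex2 _ _ _ _ _ t01 z1b z2b).
rewrite (is_prox_envelope _ _ _ _ phiN p1) (is_prox_envelope _ _ _ _ phiN p2).
rewrite (is_prox_envelope _ _ _ _ phiN p) => -[<-] -[<-].
have [psi1 _] := key _ _ yb1 w1 lt1 (sub _ _ p1).
have [psi2 _] := key _ _ yb2 w2 lt2 (sub _ _ p2).
have [_ psiy] := key _ _ yb w ylt (sub _ _ p).
rewrite (dom_fineK _ _ (phiN y1) p1.1) in psi1.
rewrite (dom_fineK _ _ (phiN y2) p2.1) in psi2.
(* At the combination of [y1] and [y2] it is [psi] that is bounded above by strong convexity; [phi]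
   may be larger there. *)
have Ux := BU _ (eball_convex2 _ _ _ _ _ t01 yb1 yb2).
have := strongly_convex_le _ _ _ _ _ _ _ _ sc (BU _ yb1) (BU _ yb2) t01 psi1 psi2.
move/(le_trans (psiy _ Ux)); rewrite !lee_fin !enorm_sqr.
set x := t *: y1 + _; set z := t *: z1 + _.
have := prox_step l y z x l0.
have -> : x - z = t *: (y1 - z1) + (1 - t) *: (y2 - z2).
  by apply/rowP => i; rewrite !mxE; ring.
rewrite inner_convex_comb.
have -> : y1 - z1 - (y2 - z2) = (y1 - y2) - (z1 - z2).
  by apply/rowP => i; rewrite !mxE; ring.
(* The strong convexity gain in [y1 - y2] and the gain from the squared distances together yield the
   modulus of the envelope in [z1 - z2]. *)
have := inf_convolution_sqr _ _ (y1 - y2) (z1 - z2) s0 l0.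
have tt : 0 <= t * (1 - t) by case/andP: t01 => ? ?; apply: mulr_ge0; lra.
move=> /(ler_wpM2l tt).
have : 0 <= sigma / 2 * inner (x - y) (x - y).
  by rewrite mulr_ge0 ?inner_ge0//; lra.
lra.
Qed.

End VariationalToEnvelope.

(** * From the envelope to variational strong convexity *)

Section EnvelopeToVariational.
Context {R : realType} {n : nat}.
Implicit Types (u v w x y z : 'rV[R]_n) (phi psi f : 'rV[R]_n -> \bar R).

(** With [h = z' - z], the point [z] is the combination of [z'] and [z - s h] with weight
    [s / (1 + s)] on [z']. The majorant bounds [f] at [z - s h], and what remains after division by
    [s] is an error of at most [e]. *)
Lemma strongly_convex_touching f (W : set 'rV[R]_n) (kappa a b c : R) z z' v :
  strongly_convex_on kappa W f -> W z' -> f z = a%:E -> f z' = b%:E ->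
  0 <= kappa -> 0 <= c ->
  (forall s : R, 0 < s < 1 -> W (z - s *: (z' - z)) /\
    (-oo < f (z - s *: (z' - z))%R)%E) ->
  (forall x, f x <= (a + inner v (x - z) + c * inner (x - z) (x - z))%:E)%E ->
  a + inner v (z' - z) + kappa / 2 * inner (z' - z) (z' - z) <= b.
Proof.
move=> sc Wz' fz fz' k0 c0.
have : z' = z + (z' - z) by rewrite addrC subrK.
move: (z' - z) => h z'E Wr maj.
have h0 : 0 <= inner h h by exact: inner_ge0.
apply/ler_addgt0Pr => e e0.
have [s [s01 se _]] : exists s : R, [/\ 0 < s < 1, s * (c * inner h h) <= e &
    s * 0 <= e] by apply: exists_small_multiple => //; exact: mulr_ge0.
have [s0 s1] := andP s01.
have s1p : 0 < 1 + s by lra.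
have [Ws fs] := Wr s s01.
have := maj (z - s *: h).
have -> : z - s *: h - z = - (s *: h).
  by apply/rowP => i; rewrite !mxE; ring.
case fsE : (f (z - s *: h)) fs => [p||]// _.
rewrite lee_fin !inner_expand => ple.
have t01 : 0 < s / (1 + s) < 1.
  by rewrite divr_gt0 ?ltr_pdivrMr; lra.
have := strongly_convex_le _ _ _ _ _ _ _ _ sc Wz' Ws t01 fz' fsE.
have -> : (s / (1 + s)) *: z' + (1 - s / (1 + s)) *: (z - s *: h) = z.
  by rewrite z'E; apply/rowP => i; rewrite !mxE; field; rewrite gt_eqF.
have -> : z' - (z - s *: h) = (1 + s) *: h.
  by rewrite z'E; apply/rowP => i; rewrite !mxE; ring.
rewrite fz lee_fin enorm_sqr innerZl innerZr.
set H := inner h h in h0 se ple *; set V := inner v h in ple *.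
move=> ale.
have {}ale : (1 + s) * a <= s * b + p - kappa / 2 * (s * (1 + s)) * H.
  apply: le_trans (ler_wpM2l (ltW s1p) ale) _; rewrite le_eqVlt; apply/orP; left.
  by apply/eqP; field; rewrite gt_eqF.
have : s * (a + V + kappa / 2 * H) <= s * (b + e).
  have : s * (s * (c * H)) <= s * e by rewrite ler_pM2l.
  have : 0 <= kappa / 2 * (s * s) * H by rewrite !mulr_ge0//; lra.
  by nra.
by rewrite ler_pM2l.
Qed.

(* [q] maximises [kappa / 2 |q|^2 - |x - u - q|^2 / (2 lambda)] for
   [kappa = sigma / (1 + sigma lambda)]; the maximum is [sigma / 2 |x - u|^2]. *)
Lemma deconvolution (sigma lambda : R) (u v x : 'rV[R]_n) :
  0 < sigma -> 0 < lambda ->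
  let q := (1 + sigma * lambda) *: (x - u) in
  let z' := u + lambda *: v + q in
  (2 * lambda)^-1 * inner (lambda *: v) (lambda *: v) + inner v q
    + sigma / (1 + sigma * lambda) / 2 * inner q q
    - (2 * lambda)^-1 * inner (x - z') (x - z') =
  inner v (x - u) + sigma / 2 * inner (x - u) (x - u).
Proof.
move=> s0 l0 q z'; have sl : 0 < sigma * lambda by rewrite mulr_gt0.
have -> : x - z' = - (lambda *: v) - (sigma * lambda) *: (x - u).
  by rewrite /z' /q; apply/rowP => i; rewrite !mxE; ring.
rewrite /q; move: (x - u) => d; rewrite !inner_expand (innerC d v).
by field; apply/andP; split; lra.
Qed.

(** Since [r / 2] is at most [1 / (2 lambda)], the subgradient inequality evaluated at [y] shows
    that [u] has an objective value no larger than the minimum. *)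
Lemma is_prox_of_proximal_subgradient phi (lambda r : R) u v y :
  (forall x, -oo < phi x)%E -> 0 < lambda -> r * lambda <= 1 -> dom phi u ->
  is_prox phi lambda (u + lambda *: v) y ->
  ((fine (phi u) + inner v (y - u) - r / 2 * enorm (y - u) ^+ 2)%:E
    <= phi y)%E ->
  is_prox phi lambda (u + lambda *: v) u.
Proof.
move=> phiN l0 rl ud [yd ymin].
rewrite [X in (_ <= X)%E -> _](dom_fineK _ _ (phiN y) yd) lee_fin => uy.
split=> [//|x]; apply: le_trans (ymin x); rewrite lee_fin.
have : (2 * lambda)^-1 * enorm (u - (u + lambda *: v)) ^+ 2 =
    (2 * lambda)^-1 * enorm (y - (u + lambda *: v)) ^+ 2 + inner v (y - u)
      - (2 * lambda)^-1 * enorm (y - u) ^+ 2.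
  have -> : u - (u + lambda *: v) = - (lambda *: v).
    by apply/rowP => i; rewrite !mxE; ring.
  have -> : y - (u + lambda *: v) = (y - u) - lambda *: v.
    by apply/rowP => i; rewrite !mxE; ring.
  move: (y - u) => d; rewrite !enorm_sqr !inner_expand (innerC d v).
  by field; lra.
have : r / 2 * enorm (y - u) ^+ 2 <= (2 * lambda)^-1 * enorm (y - u) ^+ 2.
  by rewrite ler_wpM2r ?sqr_ge0// -(div1r (2 * lambda)) ler_pdivlMr; lra.
by lra.
Qed.

(** In the segment hypothesis, [s = 1] gives the point [z'] of [deconvolution], and negative [s]
    gives the points beyond [z] used by [strongly_convex_touching]. *)
Lemma is_prox_strong_subgradient phi (W : set 'rV[R]_n) (sigma lambda : R) u v x :
  (forall x, -oo < phi x)%E -> 0 < sigma -> 0 < lambda ->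
  strongly_convex_on (sigma / (1 + sigma * lambda)) W
    (moreau_envelope lambda phi) ->
  is_prox phi lambda (u + lambda *: v) u ->
  (forall s : R, -1 <= s <= 1 ->
    let z' := u + lambda *: v + s *: ((1 + sigma * lambda) *: (x - u)) in
    W z' /\ moreau_envelope lambda phi z' \is a fin_num) ->
  ((fine (phi u) + inner v (x - u) + sigma / 2 * enorm (x - u) ^+ 2)%:E
    <= phi x)%E.
Proof.
move=> phiN s0 l0 sc up seg.
case pE : (phi x) (phiN x) => [p||]// _; last by rewrite leey.
have sl : 0 < sigma * lambda by rewrite mulr_gt0.
rewrite lee_fin enorm_sqr -addrA -(deconvolution _ _ _ _ _ s0 l0).
set z := u + lambda *: v in up seg *.
set q := (1 + sigma * lambda) *: (x - u) in seg *.
have [Wz' fz'] : W (z + q) /\ moreau_envelope lambda phi (z + q) \is a fin_num.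
  by have := seg 1; rewrite scale1r; apply; lra.
have Wr (s : R) : 0 < s < 1 -> W (z - s *: (z + q - z)) /\
    (-oo < moreau_envelope lambda phi (z - s *: (z + q - z))%R)%E.
  move=> /andP[t0 t1]; rewrite [z + q]addrC addrK -scaleNr.
  have [|Ws fs] := seg (- s); first by lra.
  by split=> //; rewrite ltNye_eq fs.
have kappa0 : 0 <= sigma / (1 + sigma * lambda) by rewrite divr_ge0; lra.
have k0 : 0 <= (2 * lambda)^-1 by rewrite invr_ge0; lra.
have Ez := is_prox_envelope _ _ _ _ phiN up.
have ple : fine (moreau_envelope lambda phi (z + q)) <=
    p + (2 * lambda)^-1 * inner (x - (z + q)) (x - (z + q)).
  rewrite -lee_fin fineK// -enorm_sqr.
  by apply: moreau_envelope_le; rewrite pE.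
have uz : u - z = - (lambda *: v) by rewrite /z opprD addNKr.
(* The fixed competitor [u] bounds the envelope everywhere, with equality at [z] and slope [v]
   there. *)
have maj y : (moreau_envelope lambda phi y <=
    (fine (phi u) + (2 * lambda)^-1 * enorm (u - z) ^+ 2 + inner v (y - z)
      + (2 * lambda)^-1 * inner (y - z) (y - z))%:E)%E.
  apply: le_trans (moreau_envelope_le _ _ _ u (fine (phi u)) _) _.
    by rewrite -dom_fineK//; exact: up.1.
  rewrite lee_fin !enorm_sqr uz.
  have -> : u - y = - (lambda *: v) - (y - z).
    by rewrite /z; apply/rowP => i; rewrite !mxE; ring.
  move: (y - z) => d; rewrite !inner_expand (innerC d v) le_eqVlt.
  by apply/orP; left; apply/eqP; field; lra.
have := strongly_convex_touching _ _ _ _ _ _ _ _ _ sc Wz' Ez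
  (esym (fineK fz')) kappa0 k0 Wr maj.
rewrite [z + q - z]addrC addKr uz enorm_sqr innerNl innerNr opprK; lra.
Qed.

Lemma envelope_variational_convexity phi xbar vbar (sigma : R) :
  proper_fun phi -> lower_semicontinuous phi -> prox_bounded phi ->
  dom phi xbar -> limiting_subdiff phi xbar vbar -> 0 < sigma ->
  prox_regular phi xbar vbar ->
  (\forall lambda \near 0^'+,
    locally_strongly_convex (sigma / (1 + sigma * lambda))
      (xbar + lambda *: vbar) (moreau_envelope lambda phi)) ->
  variationally_strongly_convex sigma phi xbar vbar.
Proof.
move=> [phiN _] lsc pb xd xv s0 [eps [r [eps0 r0 proxreg]]] env.
have xE := dom_fineK _ _ (phiN xbar) xd.
have xbarlt (e : R) : 0 < e -> (phi xbar < phi xbar + e%:E)%E.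
  by move=> e0; rewrite xE -EFinD lte_fin; lra.
have proxreg' x u v : eball xbar eps x -> eball xbar eps u -> eball vbar eps v ->
    limiting_subdiff phi u v -> (phi u < phi xbar + eps%:E)%E ->
    ((fine (phi u) + inner v (x - u) - r / 2 * enorm (x - u) ^+ 2)%:E <= phi x)%E.
  move=> xb ub vb uv ul; have := proxreg x u v xb (conj uv (conj ub vb)) ul.
  by rewrite [X in (X + _ - _)%E](dom_fineK _ _ (phiN u) uv.1) -!EFinD.
have [K K0 minor] : exists2 K, 0 <= K &
    forall x, ((fine (phi xbar) + inner vbar (x - xbar)
     - K * enorm (x - xbar) ^+ 2)%:E <= phi x)%E.
  apply: (prox_bounded_minorant _ _ _ eps r) => // x xb.
  apply: proxreg' => //; [exact/eball_center/ltW|exact/eball_center/ltW|].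
  exact: xbarlt.
(* Below this threshold both [2 * K * l < 1], for localisation, and [r * l <= 1], for
   prox-regularity, hold. *)
have K1 : 0 < (2 * K + r + 1)^-1 by rewrite invr_gt0; lra.
have [l [[W [nW _ scW]] /andP[l0 lK]]] :=
  filter_ex (filterI env (near_0_right_lt _ K1)).
have lKr : l * (2 * K + r + 1) < 1 by rewrite -ltr_pdivlMr ?div1r//; lra.
have lK0 : 0 <= l * K by rewrite mulr_ge0// ltW.
have lr0 : 0 <= l * r by rewrite mulr_ge0// ltW.
have Kl : 2 * K * l < 1 by lra.
have rl : r * l <= 1 by lra.
have sl : 0 < sigma * l by rewrite mulr_gt0.
set zbar := xbar + l *: vbar in nW.
have sub z y : is_prox phi l z y -> limiting_subdiff phi y (l^-1 *: (z - y)).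
  by move=> h; apply: regular_sub_limiting; exact: is_prox_subdiff.
have loc e := is_prox_localized _ _ _ _ _ e phiN lsc xd minor l0 Kl.
have [d1 d10 loc1] := loc eps eps0.
have /nbhs_eballP[d2 d20 dW] := nW.
pose D := Num.min d1 d2 / 3.
have D0 : 0 < D by rewrite divr_gt0// lt_min d10.
have D1 : 3 * D <= d1.
  by rewrite /D mulrCA divff// mulr1 ge_min lexx.
have D2 : 3 * D <= d2.
  by rewrite /D mulrCA divff// mulr1 ge_min lexx orbT.
(* For pairs within [rho0], both the distance from [u + l *: v] to [zbar] and the length of
   [(1 + sigma * l) *: (x - u)] are at most [D]. *)
have [rho0 [/andP[rho00 rho01] rhoD rhoe]] : exists t : R, [/\ 0 < t < 1,
    t * (1 + l + 2 * (1 + sigma * l)) <= D & t * 1 <= eps].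
  by apply: exists_small_multiple; lra.
(* [T] is the part of the subdifferential graph localised in point, slope and value. *)
pose T u v := [/\ limiting_subdiff phi u v, eball xbar rho0 u, eball vbar rho0 v
  & (phi u < phi xbar + rho0%:E)%E].
have rhoeps : rho0 <= eps by lra.
have zE u v : u + l *: v - zbar = (u - xbar) + l *: (v - vbar).
  by rewrite /zbar; apply/rowP => i; rewrite !mxE; ring.
have zclose (e : R) u v : eball xbar e u -> eball vbar e v ->
    enorm (u + l *: v - zbar) <= e * (1 + l).
  rewrite /eball/= => ub vb; rewrite zE; apply: le_trans (enormD _ _) _.
  rewrite enormZ gtr0_norm//.
  by have := ler_wpM2l (ltW l0) vb; lra.
have Tprox u v : T u v -> is_prox phi l (u + l *: v) u.
  move=> [uv ub vb ul].
  have zb : eball zbar d1 (u + l *: v).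
    rewrite /eball/=; apply: le_trans (zclose _ _ _ ub vb) _.
    have : 0 <= rho0 * (sigma * l) by rewrite mulr_ge0 ?ltW.
    by lra.
  have [y [yp yb _ _]] := loc1 _ zb.
  apply: (is_prox_of_proximal_subgradient _ _ r _ _ y) => //; first exact: uv.1.
  apply: proxreg' => //; [exact: eball_sub ub|exact: eball_sub vb|].
  by apply: lt_le_trans ul _; rewrite leeD2l// lee_fin.
have Tminor u v x : T u v -> eball xbar rho0 x ->
    ((fine (phi u) + inner v (x - u) + sigma / 2 * enorm (x - u) ^+ 2)%:E
      <= phi x)%E.
  move=> Tuv xb; have [uv ub vb ul] := Tuv.
  apply: (is_prox_strong_subgradient _ _ _ _ _ _ _ phiN s0 l0 scW
    (Tprox _ _ Tuv)).
  move=> s s1; set z := u + l *: v; set q := _ *: (x - u); move=> z'.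
  have zb : enorm (z - zbar) <= D.
    apply: le_trans (zclose _ _ _ ub vb) _.
    by have := mulr_ge0 (ltW rho00) (ltW sl); lra.
  have qb : enorm q <= D.
    rewrite enormZ gtr0_norm; last by lra.
    have : enorm (x - u) <= 2 * rho0.
      have -> : x - u = (x - xbar) - (u - xbar).
        by apply/rowP => i; rewrite !mxE; ring.
      apply: le_trans (enormB _ _) _; move: xb ub; rewrite /eball/=; lra.
    have sl1 : 0 <= 1 + sigma * l by lra.
    move=> /(ler_wpM2l sl1).
    by have := mulr_ge0 (ltW rho00) (ltW l0); lra.
  have z'b : eball zbar (3 * D) z'.
    rewrite /eball/= (_ : z' - zbar = (z - zbar) + s *: q); last first.
      by rewrite /z'; apply/rowP => i; rewrite !mxE; ring.
    apply: le_trans (enormD _ _) _; rewrite enormZ.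
    have : `|s| <= 1 by rewrite ler_norml.
    by move=> /(ler_wpM2r (enorm_ge0 q)); lra.
  split; first exact/dW/(eball_sub _ _ _ D2).
  have [y [yp _ _ _]] := loc1 _ (eball_sub _ _ _ D1 _ z'b).
  by rewrite (is_prox_envelope _ _ _ _ phiN yp).
have Tbar : T xbar vbar.
  by split; [|exact/eball_center/ltW|exact/eball_center/ltW|exact: xbarlt].
pose quad u v x :=
  fine (phi u) + inner v (x - u) + sigma / 2 * inner (x - u) (x - u).
pose psi x := ereal_sup [set (quad p.1 p.2 x)%:E | p in [set p | T p.1 p.2]].
have psi_ge u v x : T u v -> ((quad u v x)%:E <= psi x)%E.
  by move=> Tuv; apply: ereal_sup_ubound; exists (u, v).
have psiN x : (-oo < psi x)%E.
  by apply: lt_le_trans (psi_ge _ _ x Tbar); rewrite ltNyr.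
have psi_le x : eball xbar rho0 x -> (psi x <= phi x)%E.
  move=> xb; apply: ge_ereal_sup => _ [[u v] /= Tuv <-].
  by have := Tminor u v x Tuv xb; rewrite enorm_sqr.
have psiT u v : T u v -> psi u = phi u.
  move=> Tuv; have [uv ub vb ul] := Tuv.
  apply/eqP; rewrite eq_le psi_le//=; apply: le_trans (psi_ge _ _ u Tuv).
  rewrite /quad subrr -(scale0r 0) !innerZr !mul0r mulr0 !addr0.
  by rewrite -dom_fineK//; exact: uv.1.
have quadE u v (t : R) x y : quad u v (t *: x + (1 - t) *: y) =
    t * quad u v x + (1 - t) * quad u v y
    - sigma / 2 * (t * (1 - t)) * inner (x - y) (x - y).
  rewrite /quad.
  have -> : t *: x + (1 - t) *: y - u = t *: (x - u) + (1 - t) *: (y - u).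
    by apply/rowP => i; rewrite !mxE; ring.
  rewrite inner_convex_comb.
  have -> : x - u - (y - u) = x - y.
    by apply/rowP => i; rewrite !mxE; ring.
  by rewrite (innerDr (t *: _)) !innerZr; ring.
(* Each [quad u v] satisfies the inequality with equality on the whole space, so the supremum is
   strongly convex on any set. *)
have psisc (A : set 'rV[R]_n) : strongly_convex_on sigma A psi.
  apply: strongly_convex_intro => // x y t a b _ _ /andP[t0 t1] xa yb.
  apply: ge_ereal_sup => _ [[u v] /= Tuv <-].
  have := psi_ge _ _ x Tuv; have := psi_ge _ _ y Tuv.
  rewrite xa yb !lee_fin quadE enorm_sqr => qy qx.
  have := ler_wpM2l (ltW t0) qx.
  have t1' : 0 <= 1 - t by lra.
  by have := ler_wpM2l t1' qy; lra.
have psilsc : lower_semicontinuous psi.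
  move=> x a /ereal_sup_gt[_ [[u v] /= Tuv <-]]; rewrite lte_fin => ax.
  exists [set y | a < quad u v y]; last first.
    by move=> y /= ay; apply: lt_le_trans (psi_ge _ _ y Tuv); rewrite lte_fin.
  have cB : y - u @[y --> x] --> x - u.
    by apply: (@cvgB _ 'rV[R]_n _ (nbhs x)); [exact: cvg_id|exact: cvg_cst].
  have cq : quad u v y @[y --> x] --> quad u v x.
    apply: (@cvgD _ _ _ (nbhs x)).
      apply: (@cvgD _ _ _ (nbhs x)); first exact: cvg_cst.
      by apply: cvg_inner cB; exact: cvg_cst.
    apply: (@cvgM _ _ (nbhs x)); first exact: cvg_cst.
    exact: (cvg_inner _ _ _ _ _ _ _ cB cB).
  by have /cvgr_gt := cq; apply.
(* Localising with radius [rho0] makes the proximal points below produce pairs in [T]. *)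
have [d3 d30 loc3] := loc rho0 rho00.
have [rho [/andP[rhop _] rhod rhor]] : exists t : R, [/\ 0 < t < 1,
    t * (1 + l) <= d3 & t * rho0^-1 <= 1].
  by apply: exists_small_multiple; rewrite ?invr_ge0; lra.
have {}rhor : rho <= rho0 by move: rhor; rewrite ler_pdivrMr// mul1r.
have psiphi u v : eball xbar rho u -> eball vbar rho v ->
    limiting_subdiff psi u v -> T u v.
  move=> ub vb uv.
  have zb : eball zbar d3 (u + l *: v).
    by rewrite /eball/=; apply: le_trans (zclose _ _ _ ub vb) _.
  have [y [yp yb wb yl]] := loc3 _ zb.
  set w := l^-1 *: _ in wb.
  have Tyw : T y w by split => //; exact: sub.
  have uE := dom_fineK _ _ (psiN u) uv.1.
  have yE := dom_fineK _ _ (phiN y) yp.1.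
  have uT : nbhs u setT by exact: filterT.
  (* Adding the growth inequality from [(u, v)] at [y] to that from [(y, w)] at [u] gives
     [(l^-1 + sigma) |y - u|^2 <= 0], because [v - w = (y - u) / l]. *)
  have := strongly_convex_limiting _ _ _ _ _ _ psiN (ltW s0) (psisc setT) uT
    (I : setT y) uv.
  rewrite (psiT _ _ Tyw) yE lee_fin => h1.
  have := psi_ge _ _ u Tyw; rewrite uE lee_fin /quad => h2.
  have vw : v = w + l^-1 *: (y - u).
    by rewrite /w; apply/rowP => i; rewrite !mxE; field; lra.
  clearbody w; have yu : y = u.
    apply/eqP; rewrite -subr_eq0; apply/eqP/enorm_eq0/eqP.
    rewrite -sqrf_eq0 enorm_sqr.
    have uy : u - y = - (y - u) by rewrite opprB.
    move: h1 h2; rewrite uy vw enorm_sqr; move: (y - u) => e.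
    rewrite innerDl innerZl !innerNr innerNl.
    have := inner_ge0 e; move: (inner e e) (inner w e) => N M N0 h1 h2.
    have li : 0 < l^-1 by rewrite invr_gt0.
    have : (l^-1 + sigma) * N <= 0 by lra.
    by rewrite pmulr_rle0 ?addr_gt0// => N0'; rewrite eq_le N0' N0.
  by move: Tyw; rewrite vw yu subrr scaler0 addr0.
exists (eball xbar rho), (eball vbar rho), psi, rho0; split => //.
- by split; [exact: nbhs_eball|exact: eball_convex|exact: nbhs_eball|
    exact: eball_convex].
- split => //; first split => //.
    by exists xbar; rewrite /dom/= (psiT _ _ Tbar).
  by move=> x xb; apply: psi_le; exact: eball_sub _ _ _ rhor _ xb.
- apply/seteqP; split => -[u v] /=.
    move=> [[/= [ub ul] vb] uv]; split => //=.
    have Tuv : T u v.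
      by split => //; [exact: eball_sub _ _ _ rhor _ ub|
        exact: eball_sub _ _ _ rhor _ vb].
    have psiu := psiT _ _ Tuv.
    apply: regular_sub_limiting.
    (* The member of the supremum indexed by [(u, v)] touches [psi] at [u] with slope [v]. *)
    apply: (quadratic_minorant_subdiff _ _ _ 0) => //.
      by rewrite /dom/= psiu; exact: uv.1.
    move=> y; apply: le_trans (psi_ge _ _ y Tuv).
    rewrite psiu lee_fin mul0r subr0 /quad lerDl.
    by rewrite mulr_ge0 ?inner_ge0//; lra.
  move=> [[/= ub vb] uv]; have [h1 h2 h3 h4] := psiphi _ _ ub vb uv.
  by split.
- by move=> u v [[/= ub vb] uv]; rewrite -(psiT _ _ (psiphi _ _ ub vb uv)).
Qed.

End EnvelopeToVariational.

Theorem theorem4p4 (R : realType) (n : nat) (phi : 'rV[R]_n -> \bar R)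
    (xbar vbar : 'rV[R]_n) (sigma : R)
    (phi_proper : proper_fun phi)
    (phi_lsc : lower_semicontinuous phi)
    (phi_pb : prox_bounded phi)
    (xbar_dom : dom phi xbar)
    (vbar_subdiff : limiting_subdiff phi xbar vbar)
    (sigma_gt0 : 0 < sigma) :
  variationally_strongly_convex sigma phi xbar vbar <->
  (prox_regular phi xbar vbar /\
   \forall lambda \near 0^'+,
     locally_strongly_convex (sigma / (1 + sigma * lambda))
       (xbar + lambda *: vbar) (moreau_envelope lambda phi)).
Proof.
split.
  exact: variational_convexity_envelope.
by case; exact: envelope_variational_convexity.
Qed.
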